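(* Let $\sigma_x,\sigma_u>0$ and $\beta\in(0,1)$ be given, and consider the system with process noise satisfying $\|d(k)\|_2\le\epsilon_d$ for all $k\ge0$. Suppose there exist matrices $\bar P\in\mathbb{R}^{n_x\times n_x}$, $L\in\mathbb{R}^{n_u\times n_x}$, $G\in\mathbb{R}^{n_u\times n_u}$ and scalars $\alpha_1,\bar\alpha_2,\bar\alpha_3,\bar\alpha_4,\theta_0,\dots,\theta_{T-1}$ such that $\bar P$ is symmetric positive definite, $0<\alpha_1\le1$, $\bar\alpha_2\ge0$, $\bar\alpha_3\ge0$, $\bar\alpha_4\ge0$, $\bar\alpha_2\ge\epsilon_d^2/\alpha_1$, $\theta_0\ge0,\dots,\theta_{T-1}\ge0$, and $$\begin{bmatrix}\mathcal{T}(\bar P-\bar\alpha_2EE^\top) & \mathcal{B}_1(\bar P,L,-G) & 0\\ * & \mathrm{blkdiag}((\beta-\alpha_1)\bar P,\ 2\bar P-\bar\alpha_3I,\ G^\top+G-\bar\alpha_4I) & \mathcal{B}_2(L^\top,\bar P)\\ * & * & \mathrm{blkdiag}\left(\frac{\bar\alpha_4}{\sigma_u^2}I_{n_u},\ \frac{\bar\alpha_3}{\sigma_x^2}I_{n_x}\right)\end{bmatrix}\succeq0 .$$ Then, with the controller gain $K=L\bar P^{-1}$ and Lyapunov matrix $P=\bar P^{-1}$, for every $(A,B)\in\Sigma$ the event-triggered closed-loop system $$x(k+1)=Ax(k)+BKx(k)-BKe_x(k)-Be_u(k)+Ed(k),$$ $$\|e_x(k)\|_2\le\sigma_x\|x(k)\|_2,\quad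 \|e_u(k)\|_2\le\sigma_u\|u(k)\|_2,\quad u(k)=K(x(k)-e_x(k)),$$ is uniformly ultimately bounded in the set $\mathcal{S}=\{x\in\mathbb{R}^{n_x}: x^\top Px\le1\}$.
   Context: Dimensions and data. $n_x,n_u,n_d,T$ are positive integers; $E\in\mathbb{R}^{n_x\times n_d}$ is known. The plant is $x(k+1)=A_*x(k)+B_*\hat u(k)+Ed(k)$ with unknown stabilizable $(A_*,B_* )$, $A_*\in\mathbb{R}^{n_x\times n_x}$, $B_*\in\mathbb{R}^{n_x\times n_u}$. In a data collection experiment, with $x(k+1)=A_*x(k)+B_*u(k)+Ed(k)$, one records $x_m(k)=x(k)+\delta_x(k)$ ($k=0,\dots,T$) and $u_m(k)=u(k)+\delta_u(k)$ ($k=0,\dots,T-1$), where $\|d(k)\|_2\le\epsilon_d$ and $\|\delta_u(k)\|_2\le\epsilon_u$ for $k=0,\dots,T-1$ and $\|\delta_x(k)\|_2\le\epsilon_x$ for $k=0,\dots,T$, with known constants $\epsilon_d,\epsilon_x,\epsilon_u>0$. Define for $k=0,\dots,T-1$ $$\Psi_k=F\,\Pi\,F^\top-v_kv_k^\top,\quad F=\begin{bmatrix}E&0&I&0\\0&-I&0&0\\0&0&0&-I\end{bmatrix},\quad \Pi=\mathrm{blkdiag}(4\epsilon_d^2I,4\epsilon_x^2I,4\epsilon_x^2I,4\epsilon_u^2I),\quad v_k=\begin{bmatrix}x_m(k+1)\\-x_m(k)\\-u_m(k)\end{bmatrix},$$ where the block sizes in $\Pi$ are $n_d,n_x,n_x,n_u$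 and the block rows of $F$ have sizes $n_x,n_x,n_u$. The uncertainty set is $$\Sigma=\bigcap_{k=0}^{T-1}\left\{(A,B)\in\mathbb{R}^{n_x\times n_x}\times\mathbb{R}^{n_x\times n_u}:\ \begin{bmatrix}I\\ A^\top\\ B^\top\end{bmatrix}^\top\Psi_k\begin{bmatrix}I\\ A^\top\\ B^\top\end{bmatrix}\succeq0\right\}.$$ Block notation (block rows of sizes $n_x,n_x,n_u$): $\mathcal{B}_1(X_1,X_2,X_3)=\begin{bmatrix}0&0&0\\ X_1&0&0\\ X_2&-X_2&X_3\end{bmatrix}$ (block columns $n_x,n_x,n_u$), $\mathcal{B}_2(X_1,X_2)=\begin{bmatrix}X_1&X_2\\-X_1&0\\0&0\end{bmatrix}$ (block columns $n_u,n_x$), $\mathcal{T}(X)=\mathrm{blkdiag}(X,0,0)-\sum_{i=0}^{T-1}\theta_i\Psi_i$ (with $X\in\mathbb{R}^{n_x\times n_x}$). The symbol $*$ denotes blocks determined by symmetry; $\succeq0$ means symmetric positive semidefinite. Event-triggered closed loop. The controller is $u(k)=K\hat x(k)$, where $\hat x(k)$ is the most recently transmitted state and $\hat u(k)$ the most recently transmitted input; $e_x(k)=x(k)-\hat x(k)$, $e_u(k)=u(k)-\hat u(k)$. The triggering rules (transmit $x(k)$ when $\|x(k)-\hat x(k)\|_2>\sigma_x\|x(k)\|_2$; transmit $u(k)$ when $\|u(k)-\hat u(k)\|_2>\sigma_u\|u(k)\|_2$; first transmissions at $k=0$) guarantee the two stated error inequalities for all $k\in\mathbb{N}$, and these inequalities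 are the event-triggered condition. Uniformly ultimately bounded (UUB) in a compact set $\mathcal{S}$ means: for any initial state $x(0)$ there exists $N\ge0$ such that $x(k)\in\mathcal{S}$ for all $k\ge N$. The Lyapunov function associated with the Lyapunov matrix $P$ is $V(k)=x(k)^\top Px(k)$. *)

(* Defs.v *)
From HB Require Import structures.
From mathcomp Require Import all_boot all_order all_algebra.
From mathcomp Require Import boolp classical_sets reals topology normedtype.
From mathcomp Require Import complex.

Set Implicit Arguments.
Unset Strict Implicit.
Unset Printing Implicit Defensive.

Import Order.TTheory GRing.Theory Num.Theory.
Import numFieldNormedType.Exports.

Local Open Scope classical_set_scope.
Local Open Scope ring_scope.

(* The library norm `|v| on matrices is the sup norm, hence this definition. *)
Definition norm2 (R : realType) (n : nat) (v : 'cV[R]_n) : R :=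
  Num.sqrt (\sum_(i < n) v i 0 ^+ 2).

Definition qform (R : realType) (n : nat) (M : 'M[R]_n) (v : 'cV[R]_n) : R :=
  (v^T *m M *m v) 0 0.

Definition psd (R : realType) (n : nat) (M : 'M[R]_n) : Prop :=
  M^T = M /\ forall v : 'cV[R]_n, 0 <= qform M v.

Definition posdef (R : realType) (n : nat) (M : 'M[R]_n) : Prop :=
  M^T = M /\ forall v : 'cV[R]_n, v != 0 -> 0 < qform M v.

Definition schur_stable (R : realType) (n : nat) (M : 'M[R]_n) : Prop :=
  forall z : R[i], eigenvalue (map_mx (real_complex R) M) z -> `|z| < 1.

Definition stabilizable (R : realType) (nx nu : nat)
    (A : 'M[R]_nx) (B : 'M[R]_(nx, nu)) : Prop :=
  exists K : 'M[R]_(nu, nx), schur_stable (A + B *m K).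

(* Three-by-three block matrices; blocks are always nested to the right. *)
Definition mx33 (R : realType) (m1 m2 m3 n1 n2 n3 : nat)
    (M11 : 'M[R]_(m1, n1)) (M12 : 'M[R]_(m1, n2)) (M13 : 'M[R]_(m1, n3))
    (M21 : 'M[R]_(m2, n1)) (M22 : 'M[R]_(m2, n2)) (M23 : 'M[R]_(m2, n3))
    (M31 : 'M[R]_(m3, n1)) (M32 : 'M[R]_(m3, n2)) (M33 : 'M[R]_(m3, n3)) :
    'M[R]_(m1 + (m2 + m3), n1 + (n2 + n3)) :=
  col_mx (row_mx M11 (row_mx M12 M13))
    (col_mx (row_mx M21 (row_mx M22 M23))
            (row_mx M31 (row_mx M32 M33))).

Definition sym33 (R : realType) (n1 n2 n3 : nat)
    (M11 : 'M[R]_n1) (M12 : 'M[R]_(n1, n2)) (M13 : 'M[R]_(n1, n3))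
    (M22 : 'M[R]_n2) (M23 : 'M[R]_(n2, n3)) (M33 : 'M[R]_n3) :
    'M[R]_(n1 + (n2 + n3)) :=
  mx33 M11    M12    M13
       M12^T  M22    M23
       M13^T  M23^T  M33.

Definition blkdiag2 (R : realType) (n1 n2 : nat)
    (X : 'M[R]_n1) (Y : 'M[R]_n2) : 'M[R]_(n1 + n2) :=
  block_mx X 0 0 Y.

Definition blkdiag3 (R : realType) (n1 n2 n3 : nat)
    (X : 'M[R]_n1) (Y : 'M[R]_n2) (Z : 'M[R]_n3) : 'M[R]_(n1 + (n2 + n3)) :=
  mx33 X 0 0  0 Y 0  0 0 Z.

(* The data collection experiment on the plant (A, B, E): the noisy records
   xm and um are constrained only on k <= T and k < T respectively, their
   other values being irrelevant. *)
Record data_experiment (R : realType) (nx nu nd T : nat)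
    (A : 'M[R]_nx) (B : 'M[R]_(nx, nu)) (E : 'M[R]_(nx, nd))
    (epsd epsx epsu : R)
    (x : nat -> 'cV[R]_nx) (u : nat -> 'cV[R]_nu) (d : nat -> 'cV[R]_nd)
    (deltax : nat -> 'cV[R]_nx) (deltau : nat -> 'cV[R]_nu)
    (xm : nat -> 'cV[R]_nx) (um : nat -> 'cV[R]_nu) : Prop := DataExperiment {
  experiment_dynamics : forall k, (k < T)%N ->
    x k.+1 = A *m x k + B *m u k + E *m d k;
  experiment_xm : forall k, (k <= T)%N -> xm k = x k + deltax k;
  experiment_um : forall k, (k < T)%N -> um k = u k + deltau k;
  experiment_d : forall k, (k < T)%N -> norm2 (d k) <= epsd;
  experiment_deltax : forall k, (k <= T)%N -> norm2 (deltax k) <= epsx;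
  experiment_deltau : forall k, (k < T)%N -> norm2 (deltau k) <= epsu
}.

Definition Fmx (R : realType) (nx nu nd : nat) (E : 'M[R]_(nx, nd)) :
    'M[R]_(nx + (nx + nu), nd + (nx + (nx + nu))) :=
  col_mx (row_mx E (row_mx 0 (row_mx 1%:M 0)))
    (col_mx (row_mx 0 (row_mx (- 1%:M) (row_mx 0 0)))
            (row_mx 0 (row_mx 0 (row_mx 0 (- 1%:M))))).

Definition Pimx (R : realType) (nx nu nd : nat) (epsd epsx epsu : R) :
    'M[R]_(nd + (nx + (nx + nu))) :=
  blkdiag2 (4 * epsd ^+ 2)%:M
    (blkdiag3 (4 * epsx ^+ 2)%:M (4 * epsx ^+ 2)%:M (4 * epsu ^+ 2)%:M).

Definition datavec (R : realType) (nx nu : nat)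
    (xm : nat -> 'cV[R]_nx) (um : nat -> 'cV[R]_nu) (k : nat) :
    'cV[R]_(nx + (nx + nu)) :=
  col_mx (xm k.+1) (col_mx (- xm k) (- um k)).

Definition Psi (R : realType) (nx nu nd : nat) (E : 'M[R]_(nx, nd))
    (epsd epsx epsu : R)
    (xm : nat -> 'cV[R]_nx) (um : nat -> 'cV[R]_nu) (k : nat) :
    'M[R]_(nx + (nx + nu)) :=
  Fmx nu E *m Pimx nx nu nd epsd epsx epsu *m (Fmx nu E)^T
    - datavec xm um k *m (datavec xm um k)^T.

Definition Sigma (R : realType) (nx nu nd T : nat) (E : 'M[R]_(nx, nd))
    (epsd epsx epsu : R)
    (xm : nat -> 'cV[R]_nx) (um : nat -> 'cV[R]_nu) :
    set ('M[R]_nx * 'M[R]_(nx, nu)) :=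
  \bigcap_(k in [set k : nat | (k < T)%N])
    [set AB | let W := col_mx 1%:M (col_mx AB.1^T AB.2^T) in
              psd (W^T *m Psi E epsd epsx epsu xm um k *m W)].

Definition B1mx (R : realType) (nx nu : nat)
    (X1 : 'M[R]_nx) (X2 : 'M[R]_(nu, nx)) (X3 : 'M[R]_nu) :
    'M[R]_(nx + (nx + nu), nx + (nx + nu)) :=
  mx33 0   0      0
       X1  0      0
       X2  (- X2) X3.

Definition B2mx (R : realType) (nx nu : nat)
    (X1 : 'M[R]_(nx, nu)) (X2 : 'M[R]_nx) :
    'M[R]_(nx + (nx + nu), nu + nx) :=
  col_mx (row_mx X1 X2)
    (col_mx (row_mx (- X1) 0)
            (row_mx 0 0)).

Definition Tmx (R : realType) (nx nu nd T : nat) (E : 'M[R]_(nx, nd))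
    (epsd epsx epsu : R)
    (xm : nat -> 'cV[R]_nx) (um : nat -> 'cV[R]_nu)
    (theta : 'I_T -> R) (X : 'M[R]_nx) : 'M[R]_(nx + (nx + nu)) :=
  blkdiag3 X 0 0 - \sum_(i < T) theta i *: Psi E epsd epsx epsu xm um i.

Definition lmi_matrix (R : realType) (nx nu nd T : nat) (E : 'M[R]_(nx, nd))
    (epsd epsx epsu : R)
    (xm : nat -> 'cV[R]_nx) (um : nat -> 'cV[R]_nu)
    (sigmax sigmau beta : R)
    (Pbar : 'M[R]_nx) (L : 'M[R]_(nu, nx)) (G : 'M[R]_nu)
    (alpha1 alpha2 alpha3 alpha4 : R) (theta : 'I_T -> R) :
    'M[R]_((nx + (nx + nu)) + ((nx + (nx + nu)) + (nu + nx))) :=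
  sym33
    (Tmx E epsd epsx epsu xm um theta (Pbar - alpha2 *: (E *m E^T)))
    (B1mx Pbar L (- G))
    0
    (blkdiag3 ((beta - alpha1) *: Pbar)
              (2 *: Pbar - alpha3%:M)
              (G^T + G - alpha4%:M))
    (B2mx L^T Pbar)
    (blkdiag2 (alpha4 / sigmau ^+ 2)%:M (alpha3 / sigmax ^+ 2)%:M).

(* The state trajectories of the event-triggered closed loop, for all
   admissible noises and all errors compatible with the triggering rules. *)
Definition closed_loop (R : realType) (nx nu nd : nat)
    (A : 'M[R]_nx) (B : 'M[R]_(nx, nu)) (E : 'M[R]_(nx, nd))
    (K : 'M[R]_(nu, nx)) (epsd sigmax sigmau : R) :
    set (nat -> 'cV[R]_nx) :=
  [set x | exists (u : nat -> 'cV[R]_nu) (d : nat -> 'cV[R]_nd)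
                  (ex : nat -> 'cV[R]_nx) (eu : nat -> 'cV[R]_nu),
     forall k : nat,
       [/\ x k.+1 = A *m x k + B *m K *m x k - B *m K *m ex k
                    - B *m eu k + E *m d k,
           norm2 (d k) <= epsd,
           norm2 (ex k) <= sigmax * norm2 (x k),
           norm2 (eu k) <= sigmau * norm2 (u k)
         & u k = K *m (x k - ex k)]].

(* The time N depends on the initial state only, not on the particular
   trajectory issued from it. *)
Definition uub (R : realType) (nx : nat)
    (traj : set (nat -> 'cV[R]_nx)) (S : set 'cV[R]_nx) : Prop :=
  compact S /\
  forall x0 : 'cV[R]_nx, exists N : nat,
    forall x, traj x -> x 0%N = x0 ->
    forall k : nat, (N <= k)%N -> S (x k).

(* Main.v *)
Require Import Defs.
From mathcomp Require Import all_boot all_order all_algebra.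
From mathcomp Require Import boolp classical_sets reals topology normedtype.
From mathcomp Require Import sequences ring lra.

Import Order.TTheory GRing.Theory Num.Theory.
Import numFieldNormedType.Exports.

Local Open Scope classical_set_scope.
Local Open Scope ring_scope.

(** The linear matrix inequality is used only through its values at well chosen
    vectors.  At the stacked vector [(z, y1, y2, y3, w1, w2)] with
    [z = (p, A^T p, B^T p)], the data term [- sum_i theta_i Psi_i] is
    nonpositive because [(A, B)] lies in the uncertainty set, so that for all
    [p, y1, y2, y3, w1, w2] (writing Q for Pbar, a1, ..., a4 for the scalars):

      0 <= p'Qp - a2 |E'p|^2 + 2 p'(A Q y1 + B (L y1 - L y2 - G y3))
           + (beta - a1) y1'Q y1
           + 2 y2'Q y2 - a3 |y2|^2 + 2 w2'Q y1 + a3/sigmax^2 |w2|^2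
           + 2 y3'G y3 - a4 |y3|^2 + 2 w1'(L y1 - L y2) + a4/sigmau^2 |w1|^2.

    This is [lmi_dissipation].  Along a trajectory, take [y1 = P x],
    [y2 = P ex] and [y3] with [G y3 = eu]: the bracket multiplying [2 p'] in
    the first line becomes [x+ - E d], where [x+] is the next state.
    Completing squares, [w2] and [w1] proportional to [x] and [u] make the
    last two lines nonpositive by the triggering inequalities
    ([trigger_multiplier]), and [p = - P x+] leaves

      x+'P x+ <= (beta - a1) x'P x + 2 (E'P x+)'d - a2 |E'P x+|^2
              <= (beta - a1) x'P x + |d|^2 / a2
              <= (beta - a1) x'P x + a1.

    The diagonal block of [y1] gives [0 <= beta - a1], so the Lyapunov function
    V satisfies [V+ <= beta] when [V <= 1]; and [V+ <= beta V] when [V >= 1].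
    Hence [V k <= max 1 (beta ^ k V 0)], which is at most 1 from a time on that
    depends on [V 0] alone.

    The choices above divide by a3 and invert G.  If a3 = 0, the diagonal block
    of [w2] vanishes, and a vanishing diagonal block of a positive semidefinite
    matrix forces the coupling block Q to vanish, which is absurd.  If a4 = 0,
    the same argument gives L = 0, so u and eu are zero and [y3 = 0] will do;
    otherwise [G + G^T >= a4 I] makes G invertible. *)

(** * Scalar product *)

Definition dot {R : realType} {n : nat} (u v : 'cV[R]_n) : R :=
  (u^T *m v) 0 0.

Section Dot.
Context {R : realType}.

Lemma dotE {n} (u v : 'cV[R]_n) : dot u v = \sum_(i < n) u i 0 * v i 0.
Proof. by rewrite /dot mxE; apply: eq_bigr => i _; rewrite !mxE. Qed.

Lemma dotC {n} (u v : 'cV[R]_n) : dot u v = dot v u.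
Proof. by rewrite !dotE; apply: eq_bigr => i _; rewrite mulrC. Qed.

Lemma dotDr {n} (u v w : 'cV[R]_n) : dot u (v + w) = dot u v + dot u w.
Proof. by rewrite /dot mulmxDr mxE. Qed.

Lemma dotZr {n} c (u v : 'cV[R]_n) : dot u (c *: v) = c * dot u v.
Proof. by rewrite /dot -scalemxAr mxE. Qed.

Lemma dotNr {n} (u v : 'cV[R]_n) : dot u (- v) = - dot u v.
Proof. by rewrite -scaleN1r dotZr mulN1r. Qed.

Lemma dot0r {n} (u : 'cV[R]_n) : dot u 0 = 0.
Proof. by rewrite /dot mulmx0 mxE. Qed.

Lemma dotDl {n} (u v w : 'cV[R]_n) : dot (v + w) u = dot v u + dot w u.
Proof. by rewrite !(dotC _ u) dotDr. Qed.

Lemma dotZl {n} c (u v : 'cV[R]_n) : dot (c *: v) u = c * dot v u.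
Proof. by rewrite !(dotC _ u) dotZr. Qed.

Lemma dotNl {n} (u v : 'cV[R]_n) : dot (- v) u = - dot v u.
Proof. by rewrite !(dotC _ u) dotNr. Qed.

Lemma dot0l {n} (u : 'cV[R]_n) : dot 0 u = 0.
Proof. by rewrite dotC dot0r. Qed.

Definition dot_lin := (@dotDr, @dotDl, @dotNr, @dotNl, @dotZr, @dotZl, @dot0r, @dot0l).

Lemma dot_sumr {n} (I : finType) (u : 'cV[R]_n) (f : I -> 'cV[R]_n) :
  dot u (\sum_i f i) = \sum_i dot u (f i).
Proof. by rewrite /dot mulmx_sumr summxE. Qed.

Lemma dot_mulmxl {m n} (M : 'M[R]_(m, n)) u v : dot (M *m u) v = dot u (M^T *m v).
Proof. by rewrite /dot trmx_mul mulmxA. Qed.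

Lemma dot_col_mx {m n} (u1 v1 : 'cV[R]_m) (u2 v2 : 'cV[R]_n) :
  dot (col_mx u1 u2) (col_mx v1 v2) = dot u1 v1 + dot u2 v2.
Proof. by rewrite /dot tr_col_mx mul_row_col mxE. Qed.

Lemma dot_ge0 {n} (u : 'cV[R]_n) : 0 <= dot u u.
Proof. by rewrite dotE; apply: sumr_ge0 => i _; rewrite -expr2 sqr_ge0. Qed.

Lemma dot_eq0 {n} (u : 'cV[R]_n) : dot u u = 0 -> u = 0.
Proof.
rewrite dotE => /eqP; rewrite psumr_eq0 => [/allP u0|i _]; last first.
  by rewrite -expr2 sqr_ge0.
apply/colP => i; rewrite mxE; apply/eqP.
by have := u0 i (mem_index_enum i); rewrite /= -expr2 sqrf_eq0.
Qed.

Lemma norm2_sqr {n} (u : 'cV[R]_n) : norm2 u ^+ 2 = dot u u.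
Proof.
rewrite /norm2 sqr_sqrtr ?sumr_ge0 // => [|i _]; last by rewrite sqr_ge0.
by rewrite dotE; apply: eq_bigr => i _; rewrite expr2.
Qed.

Lemma dot_le_sqr {n} (u : 'cV[R]_n) c : norm2 u <= c -> dot u u <= c ^+ 2.
Proof.
move=> uc; rewrite -norm2_sqr lerXn2r ?nnegrE ?sqrtr_ge0 //.
by apply: le_trans uc; exact: sqrtr_ge0.
Qed.

Lemma qformE {n} (M : 'M[R]_n) v : qform M v = dot v (M *m v).
Proof. by rewrite /qform /dot mulmxA. Qed.

Lemma dot_mulmx_tr {n} (M : 'M[R]_n) v : dot v (M^T *m v) = dot v (M *m v).
Proof. by rewrite -dot_mulmxl dotC. Qed.

Lemma unitmx_inj {n} (M : 'M[R]_n) :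
  (forall v : 'cV[R]_n, M *m v = 0 -> v = 0) -> M \in unitmx.
Proof.
move=> M0; rewrite -unitmx_tr -row_free_unit -kermx_eq0.
apply/eqP/row_matrixP => i.
rewrite row0; apply: (can_inj (@trmxK _ _ _)); rewrite trmx0; apply: M0.
apply: (can_inj (@trmxK _ _ _)).
by rewrite trmx_mul trmxK trmx0 -row_mul mulmx_ker row0.
Qed.

Lemma posdef_unitmx {n} {M : 'M[R]_n} : posdef M -> M \in unitmx.
Proof.
move=> [_ Mpos]; apply: unitmx_inj => v Mv; apply/eqP/negP => /negP v0.
by have := Mpos v v0; rewrite qformE Mv dot0r ltxx.
Qed.

Lemma posdef_ge0 {n} {M : 'M[R]_n} v : posdef M -> 0 <= dot v (M *m v).
Proof.
move=> [_ Mpos]; have [->|v0] := eqVneq v 0; first by rewrite dot0l.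
by rewrite -qformE ltW // Mpos.
Qed.

(** This is how a vanishing diagonal block of a positive semidefinite matrix
    forces the corresponding off-diagonal blocks to vanish. *)
Lemma affine_ge0_slope {a b : R} : (forall t, 0 <= a + t * b) -> b = 0.
Proof.
move=> ab; apply/eqP/negP => /negP b0.
by have := ab (- (a + 1) / b); rewrite divfK //; lra.
Qed.

End Dot.

(** * Compactness of ellipsoids *)

Lemma dot_delta {R : realType} {n} (x : 'cV[R]_n) i :
  dot x (delta_mx i 0) = x i 0.
Proof.
rewrite dotE (bigD1 i) //= big1 ?addr0 => [|j ji]; rewrite !mxE !eqxx ?mulr1 //.
by rewrite (negPf ji) mulr0.
Qed.

Lemma dot_delta_mulmx {R : realType} {n} (M : 'M[R]_n) i :
  dot (delta_mx i 0) (M *m delta_mx i 0) = M i i.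
Proof. by rewrite dotC dot_delta -colE mxE. Qed.

Lemma posdef_diag_gt0 {R : realType} {n} {M : 'M[R]_n} i :
  posdef M -> 0 < M i i.
Proof.
move=> [_ Mpos]; rewrite -(dot_delta_mulmx M) -qformE; apply: Mpos.
by apply/eqP => /colP /(_ i); rewrite !mxE !eqxx => /eqP; rewrite oner_eq0.
Qed.

(** This is the Cauchy-Schwarz inequality for the scalar product of
    [invmx Q], applied to [x] and [Q *m delta_mx i 0]: their product is the
    [i]-th coordinate of [x], and the second one has squared length [Q i i].
    It turns membership in an ellipsoid into a bound on each coordinate. *)
Lemma posdef_coord_le {R : realType} {n} {Q : 'M[R]_n} (x : 'cV[R]_n) i :
  posdef Q -> x i 0 ^+ 2 <= Q i i * dot x (invmx Q *m x).
Proof.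
move=> Qpos; have Qu := posdef_unitmx Qpos; have Qsym := Qpos.1.
have Qii := posdef_diag_gt0 i Qpos.
pose e : 'cV[R]_n := delta_mx i 0.
set y := invmx Q *m x.
have xy : x = Q *m y by rewrite /y mulKVmx.
have yQe : dot y (Q *m e) = x i 0 by rewrite -{1}Qsym -dot_mulmxl -xy dot_delta.
(* The value of t that minimizes the form of Q at y - t e. *)
pose t := x i 0 / Q i i.
have := posdef_ge0 (y - t *: e) Qpos.
rewrite mulmxBr -scalemxAr -xy !dot_lin dot_delta_mulmx.
rewrite (dotC e x) dot_delta (dotC y x) yQe.
rewrite (_ : _ + _ = dot x y - x i 0 ^+ 2 / Q i i); last first.
  by rewrite /t; field; rewrite gt_eqF.
by rewrite subr_ge0 ler_pdivrMr // mulrC.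
Qed.

Lemma continuous_trmx {K : numFieldType} m n :
  continuous (trmx : 'M[K]_(m, n) -> 'M[K]_(n, m)).
Proof.
move=> M A /nbhs_ballP[e e0 eA]; apply/nbhs_ballP; exists e => //= N [_ MN].
by apply: eA; split=> // i j; rewrite !mxE; apply: MN.
Qed.

Lemma closed_qform_le {R : realType} {n} (M : 'M[R]_n) (c : R) :
  closed [set x : 'cV[R]_n | (x^T *m M *m x) 0 0 <= c].
Proof.
apply: (preimage_closed _ (@closed_le _ c)) => x _.
have -> : (fun y : 'cV[R]_n => (y^T *m M *m y) 0 0)
    = (fun y => \sum_j (\sum_i y i 0 * M i j) * y j 0).
  apply: funext => y; rewrite mxE; apply: eq_bigr => j _; congr (_ * _).
  by rewrite mxE; apply: eq_bigr => i _; rewrite mxE.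
apply: continuous_big => [|j _ {}x]; first exact: add_continuous.
apply: continuousM; last exact: coord_continuous.
apply: continuous_big => [|i _ {}x]; first exact: add_continuous.
by apply: continuousM; [exact: coord_continuous | exact: cst_continuous].
Qed.

(** An ellipsoid is a closed subset of the box bounded by the square roots of
    the diagonal entries of [Q].  [rV_compact] speaks of row vectors, hence the
    transposition. *)
Lemma compact_ellipsoid {R : realType} {n} (Q : 'M[R]_n) :
  posdef Q -> compact [set x : 'cV[R]_n | (x^T *m invmx Q *m x) 0 0 <= 1].
Proof.
move=> Qpos; pose c i := Num.sqrt (Q i i).
pose box := [set v : 'rV[R]_n | forall i, `[- c i, c i]%classic (v ord0 i)].
have box_compact : compact box.
  apply: (@rV_compact _ _ (fun i => `[- c i, c i]%classic)) => i.
  exact: segment_compact.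
apply: (subclosed_compact (B := trmx @` box)).
- exact: closed_qform_le.
- apply: continuous_compact => //; apply: continuous_subspaceT.
  exact: continuous_trmx.
move=> x /= Px; exists x^T; last by rewrite trmxK.
have Px1 : dot x (invmx Q *m x) <= 1 by rewrite /dot mulmxA.
move=> i; rewrite mxE /= in_itv /= -ler_norml -sqrtr_sqr.
apply: ler_wsqrtr; apply: le_trans (posdef_coord_le x i Qpos) _.
by rewrite -[leRHS]mulr1 ler_pM2l ?posdef_diag_gt0.
Qed.

(** * The matrix inequality as a scalar inequality *)

Lemma dot_sym33 {R : realType} {n1 n2 n3}
    (M11 : 'M[R]_n1) (M12 : 'M[R]_(n1, n2)) (M13 : 'M[R]_(n1, n3))
    (M22 : 'M[R]_n2) (M23 : 'M[R]_(n2, n3)) (M33 : 'M[R]_n3) a b c :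
  let v := col_mx a (col_mx b c) in
  dot v (sym33 M11 M12 M13 M22 M23 M33 *m v) =
  dot a (M11 *m a) + dot b (M22 *m b) + dot c (M33 *m c)
  + 2 * (dot a (M12 *m b) + dot a (M13 *m c) + dot b (M23 *m c)).
Proof.
rewrite /= /sym33 /mx33 !mul_col_mx !mul_row_col !dot_col_mx !dot_lin.
rewrite -!dot_mulmxl (dotC _ a) (dotC _ a) (dotC _ b).
ring.
Qed.

Section Dissipation.
Context {R : realType} {nx nu nd T : nat} {E : 'M[R]_(nx, nd)}.
Context {epsd epsx epsu : R}.
Context {xm : nat -> 'cV[R]_nx} {um : nat -> 'cV[R]_nu}.

(** On the vectors [(p, A^T p, B^T p)] the form of each [Psi] is the form that
    defines the uncertainty set, hence is nonnegative there: the data term can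
    only help. *)
Lemma Tmx_form_le (theta : 'I_T -> R) (X A : 'M[R]_nx) (B : 'M[R]_(nx, nu)) p :
  (forall i, 0 <= theta i) -> Sigma T E epsd epsx epsu xm um (A, B) ->
  let z := col_mx p (col_mx (A^T *m p) (B^T *m p)) in
  dot z (Tmx E epsd epsx epsu xm um theta X *m z) <= dot p (X *m p).
Proof.
move=> theta0 AB /=; set z := col_mx p _.
have zE : z = col_mx 1%:M (col_mx A^T B^T) *m p by rewrite !mul_col_mx mul1mx.
rewrite /Tmx mulmxBl dotDr dotNr.
have -> : dot z (blkdiag3 X 0 0 *m z) = dot p (X *m p).
  rewrite /blkdiag3 /mx33 !mul_col_mx !mul_row_col !mul0mx !addr0.
  by rewrite !dot_col_mx !dot0r !addr0.
rewrite gerBl mulmx_suml dot_sumr; apply: sumr_ge0 => i _.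
rewrite -scalemxAl dotZr mulr_ge0 //.
have [_ /(_ p)] := AB i (ltn_ord i).
by rewrite qformE zE dot_mulmxl !mulmxA.
Qed.

(** The last two groups of terms collect what involves the state error
    (variables [y2], [w2]) and the input error (variables [y3], [w1]); each has
    the shape treated by [trigger_multiplier]. *)
Lemma lmi_dissipation sigmax sigmau beta Pbar L G alpha1 alpha2 alpha3 alpha4
    (theta : 'I_T -> R) A B p y1 y2 y3 w1 w2 :
  psd (lmi_matrix E epsd epsx epsu xm um sigmax sigmau beta
         Pbar L G alpha1 alpha2 alpha3 alpha4 theta) ->
  (forall i, 0 <= theta i) -> Sigma T E epsd epsx epsu xm um (A, B) ->
  Pbar^T = Pbar ->
  0 <= dot p (Pbar *m p) - alpha2 * dot (E^T *m p) (E^T *m p)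
     + 2 * dot p (A *m (Pbar *m y1) + B *m (L *m y1 - L *m y2 - G *m y3))
     + (beta - alpha1) * dot y1 (Pbar *m y1)
     + (2 * dot y2 (Pbar *m y2) - alpha3 * dot y2 y2
        + 2 * dot w2 (Pbar *m y1) + alpha3 / sigmax ^+ 2 * dot w2 w2)
     + (2 * dot y3 (G *m y3) - alpha4 * dot y3 y3
        + 2 * dot w1 (L *m y1 - L *m y2) + alpha4 / sigmau ^+ 2 * dot w1 w1).
Proof.
move=> [_ lmi] theta0 AB Psym.
pose z := col_mx p (col_mx (A^T *m p) (B^T *m p)).
pose y := col_mx y1 (col_mx y2 y3).
have := lmi (col_mx z (col_mx y (col_mx w1 w2))).
rewrite qformE dot_sym33 mul0mx dot0r addr0.
have -> : dot z (B1mx Pbar L (- G) *m y)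
    = dot p (A *m (Pbar *m y1) + B *m (L *m y1 - L *m y2 - G *m y3)).
  rewrite /z /y /B1mx /mx33 !mul_col_mx !mul_row_col !mul0mx !addr0.
  by rewrite !dot_col_mx !dot_mulmxl !trmxK !mulNmx dot0r add0r -dotDr addrA.
have -> : dot y (B2mx L^T Pbar *m col_mx w1 w2)
    = dot w1 (L *m y1 - L *m y2) + dot w2 (Pbar *m y1).
  rewrite /y /B2mx !mul_col_mx !mul_row_col !mul0mx !addr0 !dot_col_mx.
  rewrite !mulNmx !dot_lin.
  rewrite -!dot_mulmxl -{1}Psym -dot_mulmxl (dotC w1) (dotC w1) (dotC w2).
  ring.
have -> : dot y (blkdiag3 ((beta - alpha1) *: Pbar) (2 *: Pbar - alpha3%:M)
                          (G^T + G - alpha4%:M) *m y)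
    = (beta - alpha1) * dot y1 (Pbar *m y1)
      + (2 * dot y2 (Pbar *m y2) - alpha3 * dot y2 y2)
      + (2 * dot y3 (G *m y3) - alpha4 * dot y3 y3).
  rewrite /y /blkdiag3 /mx33 !mul_col_mx !mul_row_col !mul0mx !addr0 !add0r.
  rewrite !dot_col_mx !mulmxBl mulmxDl -!scalemxAl !mul_scalar_mx !dot_lin dot_mulmx_tr.
  ring.
have -> : dot (col_mx w1 w2)
    (blkdiag2 (alpha4 / sigmau ^+ 2)%:M (alpha3 / sigmax ^+ 2)%:M *m col_mx w1 w2)
    = alpha4 / sigmau ^+ 2 * dot w1 w1 + alpha3 / sigmax ^+ 2 * dot w2 w2.
  rewrite /blkdiag2 mul_block_col !mul0mx addr0 add0r !mul_scalar_mx.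
  by rewrite dot_col_mx !dot_lin.
have := Tmx_form_le theta (Pbar - alpha2 *: (E *m E^T)) A B p theta0 AB.
have -> : dot p ((Pbar - alpha2 *: (E *m E^T)) *m p)
    = dot p (Pbar *m p) - alpha2 * dot (E^T *m p) (E^T *m p).
  by rewrite mulmxBl -scalemxAl -mulmxA !dot_lin [in RHS]dot_mulmxl trmxK.
rewrite /= -/z; lra.
Qed.
End Dissipation.

(** * Noise and triggering errors *)

(** Completing the square, [0 <= |e - alpha y|^2]. *)
Lemma dot_young {R : realType} {n} {alpha : R} (y e : 'cV[R]_n) : 0 < alpha ->
  2 * dot y e - alpha * dot y y <= dot e e / alpha.
Proof.
move=> a0; have := dot_ge0 (e - alpha *: y).
rewrite !dot_lin (dotC e y) ler_pdivlMr //; lra.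
Qed.

(** The terms in [y] are at most [|e|^2 / alpha]; those in [w] have minimum
    [- sigma^2 |s|^2 / alpha], attained at [w = - (sigma^2 / alpha) s].  The
    triggering inequality says that the sum of both is nonpositive. *)
Lemma trigger_multiplier {R : realType} {m n} {alpha sigma : R}
    {e : 'cV[R]_m} {s : 'cV[R]_n} :
  0 < alpha -> 0 < sigma -> norm2 e <= sigma * norm2 s ->
  exists w : 'cV[R]_n, forall y : 'cV[R]_m,
    2 * dot y e - alpha * dot y y
      + 2 * dot w s + alpha / sigma ^+ 2 * dot w w <= 0.
Proof.
move=> a0 s0 /dot_le_sqr; rewrite exprMn norm2_sqr => es.
exists (- (sigma ^+ 2 / alpha) *: s) => y; rewrite !dot_lin.
have := dot_young y e a0.
have : dot e e / alpha <= sigma ^+ 2 * dot s s / alpha.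
  by rewrite ler_pM2r ?invr_gt0.
rewrite (_ : alpha / _ * _ = sigma ^+ 2 * dot s s / alpha); last first.
  by field; rewrite !gt_eqF.
lra.
Qed.

(** * Ultimate bounds for scalar sequences *)

(** Once at most 1, the sequence stays so; as long as it exceeds 1, it contracts
    by the factor [beta]. *)
Lemma max_geometric_bound {R : realType} (V : nat -> R) (beta : R) :
  0 < beta < 1 ->
  (forall k, V k.+1 <= Num.max 1 (beta * V k)) ->
  forall k, V k <= Num.max 1 (beta ^+ k * V 0%N).
Proof.
move=> /andP[b0 b1] step; elim=> [|k IH]; first by rewrite expr0 mul1r le_max lexx orbT.
apply: le_trans (step k) _; rewrite ge_max le_max lexx /=.
move: IH; rewrite !le_max exprS -mulrA => /orP[V1|Vb].
  by rewrite (le_trans _ (ltW b1)) // ler_piMr // ltW.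
by rewrite ler_pM2l // Vb orbT.
Qed.

Lemma geometric_eventually_le1 {R : realType} (beta c : R) : 0 < beta < 1 ->
  exists N, forall k, (N <= k)%N -> beta ^+ k * c <= 1.
Proof.
move=> /andP[b0 b1].
have : (fun k => beta ^+ k * c) @ \oo --> 0 * c.
  by apply: cvgMr_tmp; apply: cvg_expr; rewrite ger0_norm ?ltW.
rewrite mul0r => /cvgrPdist_le /(_ 1 ltr01) [N _ Nk]; exists N => k /Nk /=.
by rewrite sub0r normrN => /(le_trans (ler_norm _)).
Qed.

(** * Ultimate boundedness of the closed loop *)

Theorem theorem2 (R : realType) (nx nu nd T : nat)
  (nx_gt0 : (0 < nx)%N) (nu_gt0 : (0 < nu)%N) (nd_gt0 : (0 < nd)%N)
  (T_gt0 : (0 < T)%N)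
  (E : 'M[R]_(nx, nd)) (Astar : 'M[R]_nx) (Bstar : 'M[R]_(nx, nu))
  (stabAB : stabilizable Astar Bstar)
  (epsd epsx epsu : R)
  (epsd_gt0 : 0 < epsd) (epsx_gt0 : 0 < epsx) (epsu_gt0 : 0 < epsu)
  (xe : nat -> 'cV[R]_nx) (ue : nat -> 'cV[R]_nu) (de : nat -> 'cV[R]_nd)
  (deltax : nat -> 'cV[R]_nx) (deltau : nat -> 'cV[R]_nu)
  (xm : nat -> 'cV[R]_nx) (um : nat -> 'cV[R]_nu)
  (data : data_experiment T Astar Bstar E epsd epsx epsu
            xe ue de deltax deltau xm um)
  (sigmax sigmau beta : R)
  (sigmax_gt0 : 0 < sigmax) (sigmau_gt0 : 0 < sigmau)
  (beta_gt0 : 0 < beta) (beta_lt1 : beta < 1)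
  (Pbar : 'M[R]_nx) (L : 'M[R]_(nu, nx)) (G : 'M[R]_nu)
  (alpha1 alpha2 alpha3 alpha4 : R) (theta : 'I_T -> R)
  (Pbar_posdef : posdef Pbar)
  (alpha1_gt0 : 0 < alpha1) (alpha1_le1 : alpha1 <= 1)
  (alpha2_ge0 : 0 <= alpha2) (alpha3_ge0 : 0 <= alpha3)
  (alpha4_ge0 : 0 <= alpha4)
  (alpha2_ge : epsd ^+ 2 / alpha1 <= alpha2)
  (theta_ge0 : forall i : 'I_T, 0 <= theta i)
  (lmi : psd (lmi_matrix E epsd epsx epsu xm um sigmax sigmau beta
                Pbar L G alpha1 alpha2 alpha3 alpha4 theta)) :
  let K := L *m invmx Pbar in
  let P := invmx Pbar in
  forall (A : 'M[R]_nx) (B : 'M[R]_(nx, nu)),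
    Sigma T E epsd epsx epsu xm um (A, B) ->
    uub (closed_loop A B E K epsd sigmax sigmau)
        [set x : 'cV[R]_nx | (x^T *m P *m x) 0 0 <= 1].
Proof.
move=> K P A B AB.
have Pu := posdef_unitmx Pbar_posdef.
have Psym := Pbar_posdef.1.
have PK v : Pbar *m (P *m v) = v by rewrite mulKVmx.
have F p y1 y2 y3 w1 w2 := lmi_dissipation _ _ _ _ _ _ _ _ _ _ _ A B p y1 y2 y3 w1 w2
  lmi theta_ge0 AB Psym.
(* A nonzero test vector, to extract the signs of beta - alpha1 and alpha3. *)
pose e : 'cV[R]_nx := const_mx 1.
have e_neq0 : e != 0.
  apply/eqP => /colP /(_ (Ordinal nx_gt0)).
  by rewrite !mxE => /eqP; rewrite oner_eq0.
have Pe_gt0 : 0 < dot e (Pbar *m e) by rewrite -qformE; apply: Pbar_posdef.2.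
have rate_ge0 : 0 <= beta - alpha1.
  have := F 0 e 0 0 0 0.
  rewrite !mulmx0 !dot_lin !mulr0 !subr0 !addr0 !add0r.
  by rewrite pmulr_lge0.
have alpha3_gt0 : 0 < alpha3.
  rewrite lt0r alpha3_ge0 andbT; apply/eqP => a30.
  have /affine_ge0_slope : forall t, 0 <= (beta - alpha1) * dot e (Pbar *m e)
      + t * (2 * dot (Pbar *m e) (Pbar *m e)).
    move=> t; have := F 0 e 0 0 0 (t *: (Pbar *m e)).
    rewrite a30 !mulmx0 !dot_lin; lra.
  move/eqP; rewrite mulf_eq0 pnatr_eq0 /= => /eqP /dot_eq0 Pe0.
  by move: Pe_gt0; rewrite Pe0 dot0r ltxx.
have alpha2_gt0 : 0 < alpha2.
  by apply: lt_le_trans alpha2_ge; rewrite divr_gt0 ?exprn_gt0.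
have G_ge y : alpha4 * dot y y <= 2 * dot y (G *m y).
  by have := F 0 0 0 y 0 0; rewrite !mulmx0 !dot_lin; lra.
(* The sector condition on the input error, written through y with G y = eu. *)
have actuator eu u v : u = L *m v -> norm2 eu <= sigmau * norm2 u ->
    exists y w, G *m y = eu /\
      2 * dot y eu - alpha4 * dot y y + 2 * dot w u
        + alpha4 / sigmau ^+ 2 * dot w w <= 0.
  move=> uE eu_le.
  (* With alpha4 = 0 the matrix G may be singular, but then the input is 0. *)
  have [a40|a4_neq0] := eqVneq alpha4 0.
    have u0 : u = 0.
      apply: dot_eq0.
      have /affine_ge0_slope : forall t, 0 <= (beta - alpha1) * dot v (Pbar *m v)
          + t * (2 * dot u u).
        move=> t; have := F 0 v 0 0 (t *: u) 0.
        rewrite a40 -uE !mulmx0 subr0 !dot_lin; lra.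
      by move/eqP; rewrite mulf_eq0 pnatr_eq0 /= => /eqP.
    exists 0, 0; rewrite mulmx0 a40 !dot_lin; split; last by lra.
    apply/esym/dot_eq0/le_anti; rewrite dot_ge0 andbT.
    by have := dot_le_sqr _ _ eu_le; rewrite exprMn norm2_sqr u0 dot0r mulr0.
  have a4_gt0 : 0 < alpha4 by rewrite lt0r a4_neq0.
  have Gu : G \in unitmx.
    apply: unitmx_inj => y Gy; apply/dot_eq0/le_anti; rewrite dot_ge0 andbT.
    by have := G_ge y; rewrite Gy dot0r mulr0 pmulr_rle0.
  have [w w_le] := trigger_multiplier a4_gt0 sigmau_gt0 eu_le.
  by exists (invmx G *m eu), w; rewrite mulKVmx.
have V_step x : closed_loop A B E K epsd sigmax sigmau x -> forall k,
    dot (x k.+1) (P *m x k.+1) <= (beta - alpha1) * dot (x k) (P *m x k) + alpha1.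
  move=> [u [d [ex [eu traj]]]] k.
  have [x1 d_le ex_le eu_le uE] := traj k.
  have uL : u k = L *m (P *m (x k - ex k)) by rewrite uE mulmxA.
  have [y [w1 [Gy w1_le]]] := actuator _ _ _ uL eu_le.
  have [w2 w2_le] := trigger_multiplier alpha3_gt0 sigmax_gt0 ex_le.
  (* The first argument minimizes p'Pbar p + 2 p'x+ over p. *)
  have := F (- (P *m x k.+1)) (P *m x k) (P *m ex k) y w1 w2.
  have -> : L *m (P *m x k) - L *m (P *m ex k) = u k by rewrite uL !mulmxBr.
  rewrite !PK Gy.
  have -> : A *m x k + B *m (u k - eu k) = x k.+1 - E *m d k.
    by rewrite x1 uE addrK !mulmxBr !mulmxA !addrA.
  rewrite !mulmxN PK !dot_lin.
  have := w2_le (P *m ex k); move: w1_le.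
  have noise := dot_young (E^T *m (P *m x k.+1)) (d k) alpha2_gt0.
  have dd : dot (d k) (d k) / alpha2 <= alpha1.
    rewrite ler_pdivrMr // (le_trans (dot_le_sqr _ _ d_le)) //.
    by rewrite mulrC -ler_pdivrMr.
  move: noise; rewrite dot_mulmxl trmxK (dotC (P *m x k.+1) (x k.+1)) (dotC (P *m x k)).
  lra.
split; first exact: compact_ellipsoid.
move=> x0.
have b01 : 0 < beta < 1 by rewrite beta_gt0.
have [N HN] := geometric_eventually_le1 beta (dot x0 (P *m x0)) b01.
exists N => x x_traj x0E k Nk /=; rewrite -mulmxA -/(dot _ _).
pose V k := dot (x k) (P *m x k).
have Vmax j : V j.+1 <= Num.max 1 (beta * V j).
  have := V_step x x_traj j; rewrite -/(V j.+1) -/(V j) le_max => Vj.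
  have [V1|/ltW V1] := leP (V j) 1; apply/orP; [left|right].
    have := ler_wpM2l rate_ge0 V1; lra.
  have := ler_wpM2l (ltW alpha1_gt0) V1; lra.
have := max_geometric_bound V beta b01 Vmax k; rewrite le_max => /orP[//|/le_trans]; apply.
by rewrite /V x0E HN.
Qed.
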